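(* Any unateness tester (adaptive, possibly with two-sided error) for functions $f:[n]^d\to\mathbb{R}$ with distance parameter $\varepsilon\in(0,1/4)$ must make $\Omega\!\left(\frac{d\log n}{\varepsilon}-\frac{\log(1/\varepsilon)}{\varepsilon}\right)$ queries.
   Context: A function $f:[n]^d\to\mathbb{R}$ is unate if for every coordinate $i\in[d]$, $f$ is either nonincreasing in the $i$-th coordinate or nondecreasing in the $i$-th coordinate. $f$ is $\varepsilon$-far from unate if at least an $\varepsilon$ fraction of its values must be modified to make it unate. A unateness tester with distance parameter $\varepsilon$ has query access to $f$ and must accept with probability at least $2/3$ if $f$ is unate and reject with probability at least $2/3$ if $f$ is $\varepsilon$-far from unate; it may choose queries adaptively. *)

(* Defs.v *)
From HB Require Import structures.
From mathcomp Require Import all_boot all_order all_algebra.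
From mathcomp Require Import all_classical all_reals all_analysis.

Set Implicit Arguments.
Unset Strict Implicit.
Unset Printing Implicit Defensive.

Import Order.TTheory GRing.Theory Num.Theory.
Local Open Scope classical_set_scope.
Local Open Scope ring_scope.

(* The hypergrid [n]^d, with [n] represented as {0, ..., n-1}. *)
Definition hypergrid (n d : nat) : finType := {ffun 'I_d -> 'I_n}.

Section Unateness.
Variables (R : realType) (n d : nat).
Implicit Types (f g : hypergrid n d -> R) (i : 'I_d).

Definition agree_off i (x y : hypergrid n d) : Prop :=
  forall j : 'I_d, j != i -> x j = y j.

Definition nondecreasing_coord f i : Prop :=
  forall x y : hypergrid n d,
    agree_off i x y -> (x i <= y i)%N -> f x <= f y.

Definition nonincreasing_coord f i : Prop :=
  forall x y : hypergrid n d,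
    agree_off i x y -> (x i <= y i)%N -> f y <= f x.

Definition unate f : Prop :=
  forall i, nonincreasing_coord f i \/ nondecreasing_coord f i.

Definition far_from_unate (eps : R) f : Prop :=
  forall g, unate g ->
    eps * #|hypergrid n d|%:R <= #|[pred x | f x != g x]|%:R.

End Unateness.

(* Deterministic adaptive algorithms with query access to a function X -> V:
   each query may depend on the answers to all the previous ones. *)
Inductive query_algo (X V : Type) : Type :=
  | Output of bool
  | Query of X & (V -> query_algo X V).

Fixpoint accepts (X V : Type) (a : query_algo X V) (f : X -> V) : bool :=
  match a with
  | Output b => b
  | Query x k => accepts (k (f x)) f
  end.

Fixpoint num_queries (X V : Type) (a : query_algo X V) (f : X -> V) : nat :=
  match a with
  | Output _ => 0
  | Query x k => (num_queries (k (f x)) f).+1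
  end.

(* A randomized adaptive algorithm is a random deterministic one, drawn from
   an arbitrary probability space; the only measurability required is that
   acceptance of each fixed input be an event. *)
Definition unateness_tester (R : realType) (n d : nat) (eps : R)
    (disp : measure_display) (Omega : measurableType disp)
    (P : probability Omega R) (A : Omega -> query_algo (hypergrid n d) R)
    : Prop :=
  [/\ forall f, measurable [set w | accepts (A w) f],
      forall f, unate f ->
        ((2 / 3)%:E <= P [set w | accepts (A w) f])%E
    & forall f, far_from_unate eps f ->
        ((2 / 3)%:E <= P [set w | ~~ accepts (A w) f])%E].

Definition makes_at_most (X V Omega : Type) (A : Omega -> query_algo X V)
    (q : nat) : Prop :=
  forall w f, (num_queries (A w) f <= q)%N.

(* Main.v *)
Require Import Defs.
From mathcomp Require Import all_boot all_order all_algebra.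
From mathcomp Require Import all_classical all_reals all_analysis.
From mathcomp Require Import measurable_realfun zify lra.

(* Write the points of the hypergrid in binary, coordinate after coordinate,
   most significant bits first, and let the j-th digit of f(x), in a large
   base, be the j-th bit of x plus a random weight attached to the first j bits
   of x (a node of the binary tree). Such an f is monotone. Complementing the
   bit at one level, inside one block of about 4 eps n^d points, makes f
   eps-far from unate: the block then contains many decreasing and many
   increasing pairs along the same coordinate. (For n = 2 there is no second
   bit, and the increasing pairs are taken in another block.)
   The complementation can be absorbed by adding 1 to or subtracting 1 from the
   weights of the nodes concerned, unless two queries branch at one of these
   nodes. Since q queries branch at no more than q nodes, whereas the number of
   pairs (level, block) is of order log(eps n^d) / eps, an algorithm making
   fewer queries cannot tell most of the modified functions from f. Unlike
   arguments based on Ramsey's theorem, this handles algorithms that look at the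
   values and not only at their order. *)

Import Order.TTheory GRing.Theory Num.Theory.

(** * Random digit codes *)

Fixpoint queries {X V : Type} (a : query_algo X V) (f : X -> V) : seq X :=
  match a with
  | Output _ => [::]
  | Query x k => x :: queries (k (f x)) f
  end.

Lemma size_queries {X V : Type} (a : query_algo X V) f :
  size (queries a f) = num_queries a f.
Proof. by elim: a => //= x k ->. Qed.

Lemma eq_in_queries {X : eqType} {V : Type} (a : query_algo X V) f g :
  {in queries a f, f =1 g} ->
  queries a g = queries a f /\ accepts a g = accepts a f.
Proof.
elim: a => //= x k IH fg.
have <- : f x = g x by apply: fg; rewrite mem_head.
have [|-> ->] // := IH (f x).
by move=> y yQ; apply: fg; rewrite in_cons yQ orbT.
Qed.

Fixpoint horner_digits (b : nat) (u : nat -> nat) (m : nat) : nat :=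
  if m is m'.+1 then horner_digits b u m' * b + u m' else 0.

Lemma eq_horner_digits b u v m :
  (forall j, j < m -> u j = v j) -> horner_digits b u m = horner_digits b v m.
Proof.
elim: m => //= m IH uv; rewrite uv // IH // => j jm.
by apply: uv; rewrite ltnS ltnW.
Qed.

(** Lexicographic comparison: a strict deficit at one digit is multiplied by [b] at each later step,
    and a further digit of [u], being below [b], cannot make up for it. *)
Lemma ltn_horner_digits b u v m j :
  (forall i, i < m -> u i < b) -> j < m ->
  (forall i, i < j -> u i = v i) -> u j < v j ->
  horner_digits b u m < horner_digits b v m.
Proof.
move=> ub jm uv uvj; elim: m ub jm => //= m IH ub.
rewrite ltnS leq_eqVlt => /orP[/eqP<-|jm].
  by rewrite (eq_horner_digits _ u v) // ltn_add2l.
have lt : horner_digits b u m < horner_digits b v m.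
  by apply: IH => // i im; apply: ub; rewrite ltnS ltnW.
apply: (@leq_trans ((horner_digits b u m).+1 * b)); last first.
  by rewrite (leq_trans _ (leq_addr _ _)) // leq_mul2r lt orbT.
by rewrite mulSn addnC ltn_add2r ub.
Qed.

Section DigitCodes.
Variables (X V : finType) (m k : nat).
Variables (c : nat -> X -> bool) (node : nat -> X -> V).
Implicit Types (w : {ffun V -> 'I_k.+2}) (U : pred V) (Q : seq X) (x y : X).

Definition digit w U x j : nat := w (node j x) + (c j x (+) U (node j x)).

Definition code w U x : nat := horner_digits k.+3 (digit w U x) m.

Lemma digit_lt w U x j : digit w U x j < k.+3.
Proof.
have := ltn_ord (w (node j x)); rewrite /digit; case: (_ (+) _); lia.
Qed.

Definition visited Q v b : bool :=
  has (fun x => [exists j : 'I_m, (node j x == v) && (c j x == b)]) Q.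

(* Recoding the weight of the flipped nodes so that the digits read along [Q]
   are unchanged. *)
Definition recode Q U w : {ffun V -> 'I_k.+2} :=
  [ffun v => if ~~ U v then w v
             else if visited Q v true then inord (w v).+1
             else if visited Q v false then inord (w v).-1 else w v].

(** The weights that can move by one in either direction and stay within the alphabet. *)
Definition inner w : bool := [forall v, (0 < w v) && (w v < k.+1)].

(** At a flipped node seen only on side [true], the flip turns the added bit 1 into 0 and the weight
    rises by 1; on side [false] the bit turns from 0 into 1 and the weight drops by 1. Both
    compensate exactly. *)
Lemma code_recode Q U w : inner w -> 
  (forall v, U v -> ~~ (visited Q v true && visited Q v false)) ->
  {in Q, code (recode Q U w) U =1 code w pred0}.
Proof.
move=> /forallP wi Qbr x xQ; apply: eq_horner_digits => j jm.
rewrite /digit ffunE /=; have [Uv/=|//] := boolP (U (node j x)).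
have vis : visited Q (node j x) (c j x).
  by apply/hasP; exists x => //; apply/existsP; exists (Ordinal jm); rewrite /= !eqxx.
have /andP[w0 wk] := wi (node j x).
have := Qbr _ Uv; case: (c j x) vis => vis; rewrite vis /=.
  by move=> _; rewrite inordK; lia.
by rewrite andbT => /negbTE ->; rewrite inordK; lia.
Qed.

Lemma recode_inj Q U : {in inner &, injective (recode Q U)}.
Proof.
move=> w1 w2 /forallP w1i /forallP w2i /ffunP e; apply/ffunP => v.
have := e v; rewrite !ffunE.
have /andP[? ?] := w1i v; have /andP[? ?] := w2i v.
case: ifP => // _; case: ifP => _; last case: ifP => // _.
  move=> /(congr1 val) /=; rewrite !inordK; try lia.
  by move=> [] /val_inj.
move=> /(congr1 val) /=; rewrite !inordK; try lia.
by move=> ?; apply: val_inj => /=; lia.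
Qed.

Lemma card_inner : #|inner| = k ^ #|V|.
Proof.
pose R := [pred i : 'I_k.+2 | (0 < i) && (i < k.+1)].
have -> : #|inner| = #|@ffun_on V R|.
  apply: eq_card => w; rewrite -[LHS]topredE /=.
  by apply/forallP/ffun_onP => H v; have := H v; rewrite inE.
rewrite (@card_ffun_on V); congr (_ ^ _).
rewrite -sum1_card big_mkcond /= big_ord_recr big_ord_recl /=.
rewrite !inE ltnn andbF /= add0n addn0 -[RHS](card_ord k) -sum1_card.
by apply: eq_bigr => i _; rewrite inE /= /bump /= add1n ltnS ltn_ord.
Qed.

Variable (T : Type) (emb : nat -> T).

(* Replacing [w] by its recoding is undetectable by an algorithm whose queries
   do not separate the two sides of a flipped node, and [w] can be recovered
   from its recoding by running the algorithm. *)
Lemma leq_card_accepts (a : query_algo X T) U :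
  #|[pred w | inner w && accepts a (emb \o code w pred0)
      && [forall v, U v ==> let Q := queries a (emb \o code w pred0) in
           ~~ (visited Q v true && visited Q v false)]]|
  <= #|[pred w | accepts a (emb \o code w U)]|.
Proof.
set P := [pred w | _ && _]; pose Q w := queries a (emb \o code w pred0).
pose r w := recode (Q w) U w.
have main w : P w -> queries a (emb \o code (r w) U) = Q w
    /\ accepts a (emb \o code (r w) U).
  case/andP => /andP[wi acc] /forallP nb.
  have [] := @eq_in_queries _ _ a (emb \o code w pred0) (emb \o code (r w) U).
    move=> x xQ /=; rewrite /r code_recode // => v Uv.
    by have := nb v; rewrite Uv.
  by move=> -> ->.
rewrite -(@card_in_image _ _ r P); last first.
  move=> w1 w2 P1 P2 e.
  have Qe : Q w1 = Q w2 by case: (main _ P1) => <- _; case: (main _ P2) => <- _; rewrite e.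
  move: e; rewrite /r Qe; apply: recode_inj.
    by case/andP: P1 => /andP[].
  by case/andP: P2 => /andP[].
apply: subset_leq_card; apply/fintype.subsetP => v /fintype.imageP[w Pw ->].
by rewrite inE; case: (main w).
Qed.

End DigitCodes.

(** * Averaging and branching *)

Section Averaging.
Variables (R : realType) (disp : measure_display) (Omega : measurableType disp).
Variable P : probability Omega R.

Lemma integral_sum_indicator (I : Type) (s : seq I) (A : I -> pred Omega) :
  (forall i, measurable [set t | A i t]%classic) ->
  (\int[P]_t (\sum_(i <- s) (A i t)%:R%:E) = \sum_(i <- s) P [set t | A i t]%classic)%E.
Proof.
move=> mA.
have AE i : (fun t => (A i t)%:R%:E : \bar R)
    = (fun t => (\1_([set t | A i t]%classic) t)%:E).
  apply/funext => t; rewrite indicE; congr (_%:R%:E); congr nat_of_bool.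
  by apply/idP/idP; rewrite inE.
rewrite ge0_integral_sum //.
  by apply: eq_bigr => i _; rewrite AE integral_indic // setIT.
by move=> i; rewrite AE; apply/measurable_EFinP; apply: measurable_indic.
Qed.

(** Integrating over the random seed turns a counting inequality, valid for every deterministic
    algorithm, into one between acceptance probabilities. *)
Lemma sum_probability_le (I J : Type) (s : seq I) (r : seq J)
    (A : I -> pred Omega) (B : J -> pred Omega) (C : nat) :
  (forall i, measurable [set t | A i t]%classic) ->
  (forall j, measurable [set t | B j t]%classic) ->
  (forall t, (\sum_(i <- s) A i t <= \sum_(j <- r) B j t + C)%N) ->
  (\sum_(i <- s) P [set t | A i t]%classic
     <= \sum_(j <- r) P [set t | B j t]%classic + C%:R%:E)%E.
Proof.
move=> mA mB AB.
have mS (K : Type) (u : seq K) (D : K -> pred Omega) :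
    (forall i, measurable [set t | D i t]%classic) ->
    measurable_fun setT (fun t => (\sum_(i <- u) (D i t)%:R%:E)%E : \bar R).
  move=> mD; apply: emeasurable_sum => i.
  apply/measurable_EFinP.
  rewrite (_ : (fun t => _) = (\1_([set t | D i t]%classic))%R); first exact: measurable_indic.
  apply/funext => t; rewrite indicE; congr (_%:R)%R.
  by congr nat_of_bool; apply/idP/idP; rewrite inE.
have s0 (K : Type) (u : seq K) (D : K -> pred Omega) t :
    (0 <= \sum_(i <- u) (D i t)%:R%:E :> \bar R)%E.
  by apply: sume_ge0 => i _; rewrite lee_fin ler0n.
rewrite -!integral_sum_indicator //.
have -> : (C%:R%:E = \int[P]_t cst C%:R%:E t :> \bar R)%E.
  by rewrite integral_cst // [X in (_ * X)%E]probability_setT mule1.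
rewrite -ge0_integralD //; last by move=> *; rewrite lee_fin ler0n.
  apply: ge0_le_integral => //.
  + exact: mS.
  + exact: (emeasurable_funD (mS _ r _ mB) (@measurable_cst _ _ _ _ setT C%:R%:E)).
  + move=> t _ /=; rewrite !sumEFin -EFinD lee_fin -!natr_sum -natrD ler_nat.
    exact: AB.
exact: mS.
Qed.

End Averaging.

Section Branching.
Variables (X : finType) (m : nat) (c : nat -> X -> bool).

(** The nodes of all levels live in one finite type, the bit sequences of length at most [m]; the
    length gives the level back. Beyond [m] a default value appears, hence the bounds [j <= m]
    below. *)
Definition prefix_node (j : nat) (x : X) : m.-bseq bool :=
  insub_bseq m (mkseq (c^~ x) j).

Lemma prefix_node_eqP j x y : j <= m ->
  reflect (forall i, i < j -> c i x = c i y) (prefix_node j x == prefix_node j y).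
Proof.
move=> jm; rewrite -val_eqE /= !insubdK ?unfold_in ?size_mkseq //.
apply: (iffP eqP) => [e i ij|H].
  by have := congr1 (nth false ^~ i) e; rewrite !nth_mkseq.
by apply: (@eq_from_nth _ false); rewrite !size_mkseq // => i ij; rewrite !nth_mkseq ?H.
Qed.

Lemma prefix_node_level j j' x y : j <= m -> j' <= m ->
  prefix_node j x = prefix_node j' y -> j = j'.
Proof.
move=> jm j'm /(congr1 (fun v => size (val v))).
by rewrite /= !insubdK ?unfold_in ?size_mkseq.
Qed.

Local Notation visited := (visited X _ m c prefix_node).

Lemma visitedP Q v b :
  reflect (exists x j, [/\ x \in Q, j < m, prefix_node j x = v & c j x = b]) (visited Q v b).
Proof.
apply: (iffP hasP) => [[x xQ /existsP[j /andP[/eqP <- /eqP <-]]]|].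
  by exists x, j.
case=> x [j [xQ jm <- <-]]; exists x => //.
by apply/existsP; exists (Ordinal jm); rewrite /= !eqxx.
Qed.

Definition branching Q v := visited Q v true && visited Q v false.

(** Each query adds at most one branching node: the place where its path leaves the subtree spanned
    by the other queries. *)
Lemma card_branching Q : #|branching Q| <= size Q.
Proof.
elim: Q => [|x Q IH]; first by rewrite leqn0; apply/pred0P => v.
pose N := [pred v | branching (x :: Q) v && ~~ branching Q v].
have -> : #|branching (x :: Q)| = #|[predU branching Q & N]|.
  apply: eq_card => v; rewrite !inE /in_mem /= /branching /=.
  case: (visited Q v true); case: (visited Q v false); rewrite /= ?orbT ?andbT ?orbF //.
have NP v : N v -> exists j, [/\ j < m, prefix_node j x = v,
    visited Q v (~~ c j x) & ~~ visited Q v (c j x)].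
  rewrite /N /= /branching /=.
  case/andP => /andP[]; case/orP => [/existsP[j /andP[/eqP jv /eqP cj]] | vt];
    case/orP => [/existsP[j' /andP[/eqP jv' /eqP cj']] | vf]; rewrite ?vt ?vf ?andbT //= => nv.
  - have jj' : j = j' :> nat by apply: (prefix_node_level j j' x x); rewrite ?jv ?jv' //; exact: ltnW.
    by move: cj; rewrite jj' cj'.
  - by exists j; split; rewrite ?cj.
  - by exists j'; split; rewrite ?cj'.
have N1 : #|N| <= 1.
  apply/card_le1_eqP => v1 v2 /NP[j1 [j1m e1 w1 n1]] /NP[j2 [j2m e2 w2 n2]].
  (* Were there new branching nodes at two levels [j < j'] of the path of [x], an older query
     through the deeper one would pass the upper one on the same side as [x], so that side would not
     be new. *)
  have lt j j' v v' : j < j' -> j < m -> j' < m -> prefix_node j x = v -> prefix_node j' x = v' ->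
      visited Q v' (~~ c j' x) -> ~~ visited Q v (c j x) -> False.
    move=> jj' jm j'm ev ev' /visitedP[y [j'' [yQ j''m ey _]]] /negP; apply.
    have jE : j'' = j' by apply: (prefix_node_level j'' j' y x); [exact: ltnW..|rewrite ey].
    move: ey; rewrite jE -ev' => /eqP/prefix_node_eqP ey.
    apply/visitedP; exists y, j; split=> //.
      rewrite -ev; apply/eqP/prefix_node_eqP; first exact: ltnW.
      by move=> i ij; apply: ey; [exact: ltnW | exact: ltn_trans jj'].
    by apply: ey => //; exact: ltnW.
  have [j12|j21|j12] := ltngtP j1 j2.
  - by case: (lt _ _ _ _ j12 j1m j2m e1 e2 w2 n1).
  - by case: (lt _ _ _ _ j21 j2m j1m e2 e1 w1 n2).
  - by rewrite -e1 -e2 j12.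
apply: (leq_trans (leq_addr #|[predI branching Q & N]| _)).
by rewrite cardUI /= -addn1 leq_add.
Qed.

End Branching.

(** * Query lower bound from pairwise disjoint sets of flipped nodes *)

Section QueryLowerBound.
Variables (R : realType) (X : finType) (m k : nat) (c : nat -> X -> bool).
Variables (I : finType) (E : pred I) (U : I -> pred (m.-bseq bool)).
Hypothesis U_disjoint : forall e e' v, E e -> E e' -> U e v -> U e' v -> e = e'.

Local Notation weights := {ffun m.-bseq bool -> 'I_k.+2}.
Definition code_fun (w : weights) (B : pred (m.-bseq bool)) (x : X) : R :=
  (code X _ m k c (prefix_node X m c) w B x)%:R%R.
Local Notation inner := (inner (m.-bseq bool) k).

(** For a fixed [w], at most [q] indices [e] are bad, meaning that the run on the unmodified code
    branches at a node of [U e]: there are at most [q] branching nodes and the sets [U e] are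
    disjoint. For the other pairs recoding is injective and preserves acceptance. Only inner weights
    are charged, hence the error term [q * k ^ N]. *)
Lemma sum_accepts_le (a : query_algo X R) q :
  (forall f, num_queries a f <= q) ->
  \sum_(p : I * weights | E p.1 && inner p.2) accepts a (code_fun p.2 pred0)
  <= \sum_(p : I * weights | E p.1) accepts a (code_fun p.2 (U p.1))
     + q * k ^ #|{: m.-bseq bool}|.
Proof.
move=> aq.
pose Q w := queries a (code_fun w pred0).
pose bad e w := [exists v, U e v && branching X m c (Q w) v].
have badq w : \sum_(e | E e) bad e w <= q.
  apply: (@leq_trans #|branching X m c (Q w)|); last first.
    by rewrite (leq_trans (card_branching _ _ _ _)) // size_queries.
  apply: (@leq_trans (\sum_(e | E e) \sum_v (U e v && branching X m c (Q w) v))).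
    apply: leq_sum => e _; rewrite /bad; case: existsP => // -[v Uv].
    by rewrite (bigD1 v) //= Uv.
  rewrite exchange_big /= -sum1_card [leqRHS]big_mkcond /=.
  apply: leq_sum => v _; rewrite -topredE /=.
  case: (branching X m c (Q w) v); last by rewrite big1 // => e _; rewrite andbF.
  under eq_bigr do rewrite andbT.
  have [e /andP[Ee Uev]|none] := pickP (fun e => E e && U e v).
    rewrite (bigD1 e) //= Uev big1 // => e' /andP[Ee' ne].
    by case: (boolP (U e' v)) => // Ue'v; rewrite (U_disjoint e e' v) ?eqxx in ne.
  by rewrite big1 // => e Ee; have := none e; rewrite Ee => /= ->.
rewrite -(pair_big E inner (fun e w => accepts a (code_fun w pred0) : nat)).
rewrite (eq_bigl (fun p : I * weights => E p.1 && xpredT p.2)); last by move=> p; rewrite andbT.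
rewrite -(pair_big E xpredT (fun e w => accepts a (code_fun w (U e)) : nat)) /=.
apply: (@leq_trans (\sum_(e | E e) (\sum_w accepts a (code_fun w (U e))
    + \sum_(w | inner w) bad e w))).
  apply: leq_sum => e _.
  have := @leq_card_accepts X _ m k c (prefix_node X m c) R (fun i => i%:R%R) a (U e).
  move=> main; have -> : \sum_w accepts a (code_fun w (U e))
      = #|[pred w | accepts a (code_fun w (U e))]|.
    rewrite -sum1_card [RHS]big_mkcond; apply: eq_bigr => w _; rewrite inE.
    by case: accepts.
  apply: (leq_trans _ (leq_add main (leqnn _))).
  rewrite -sum1_card [leqLHS]big_mkcond [X in _ <= X + _]big_mkcond.
  rewrite [X in _ <= _ + X]big_mkcond -big_split /=.
  apply: leq_sum => w _; rewrite !inE -/(code_fun w pred0).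
  rewrite -[accepts a (_ \o _)]/(accepts a (code_fun w pred0)).
  case: (inner w) => //=; case: (accepts _ _) => //=.
  case: forallP => //= nb; suff -> : bad e w by [].
  apply/existsP; apply: contrapT => nex; apply: nb => v; apply/implyP => Uv.
  apply/negP => br; apply: nex; exists v; rewrite Uv.
  exact: br.
rewrite big_split leq_add //= exchange_big /=.
apply: (@leq_trans (\sum_(w | inner w) q)); first by apply: leq_sum => w _; apply: badq.
by rewrite sum_nat_const card_inner mulnC.
Qed.

Variables (disp : measure_display) (Omega : measurableType disp).
Variables (P : probability Omega R) (A : Omega -> query_algo X R) (q : nat).

(** The alphabet is so large that at least two thirds of the weights are inner. Averaged over the
    weights, acceptance must fall from 2/3 to 1/3 under each flip, while all flips together have
    only the error term of the preceding count to spend. *)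
Lemma query_lower_bound :
  2 * k.+2 ^ #|{: m.-bseq bool}| <= 3 * k ^ #|{: m.-bseq bool}| ->
  (forall f, measurable [set t | accepts (A t) f]%classic) ->
  (forall w, (2 / 3)%:E <= P [set t | accepts (A t) (code_fun w pred0)]%classic)%E ->
  (forall e w, E e ->
     (P [set t | accepts (A t) (code_fun w (U e))]%classic <= (1 / 3)%:E)%E) ->
  makes_at_most A q ->
  #|E| <= 6 * q.
Proof.
move=> kN mA yes no Aq; set N := #|_| in kN.
have main : (\sum_(p : I * weights | E p.1 && inner p.2)
      P [set t | accepts (A t) (code_fun p.2 pred0)]%classic
    <= \sum_(p : I * weights | E p.1)
      P [set t | accepts (A t) (code_fun p.2 (U p.1))]%classic + (q * k ^ N)%:R%:E)%E.
  rewrite -[X in (X <= _)%E]big_filter -[X in (_ <= X + _)%E]big_filter.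
  apply: sum_probability_le => [p|p|t]; [exact: mA|exact: mA|].
  by rewrite !big_filter; apply: sum_accepts_le => f; apply: Aq.
have sum_const (B : pred (I * weights)) (x : R) :
    (\sum_(p | B p) x%:E = (x *+ #|B|)%:E)%E.
  by rewrite sumEFin sumr_const.
have cardB : #|[pred p : I * weights | E p.1 && inner p.2]| = #|E| * k ^ N.
  by rewrite -(@card_inner _ k) -cardX; apply: eq_card => p; rewrite !inE.
have cardB' : #|[pred p : I * weights | E p.1]| = #|E| * k.+2 ^ N.
  have -> : k.+2 ^ N = #|{: weights}| by rewrite card_ffun card_ord.
  by rewrite -cardX; apply: eq_card => p; rewrite !inE andbT.
have lo : (((2 / 3) *+ (#|E| * k ^ N))%:E <= \sum_(p : I * weights | E p.1 && inner p.2)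
    P [set t | accepts (A t) (code_fun p.2 pred0)]%classic)%E.
  rewrite -cardB -sum_const; apply: lee_sum => p _; exact: yes.
have hi : (\sum_(p : I * weights | E p.1)
    P [set t | accepts (A t) (code_fun p.2 (U p.1))]%classic
    <= ((1 / 3) *+ (#|E| * k.+2 ^ N))%:E)%E.
  rewrite -cardB' -sum_const; apply: lee_sum => p Ep; exact: no.
have := le_trans lo (le_trans main (leeD2r _ hi)).
rewrite -EFinD lee_fin -[X in (X <= _)%R]mulr_natr -[X in (_ <= X + _)%R]mulr_natr => bound.
have {bound} : (#|E| * k ^ N * 2 <= #|E| * k.+2 ^ N + 3 * (q * k ^ N))%N.
  rewrite -(ler_nat R) natrD (natrM _ _ 2) (natrM _ 3); lra.
have kN0 : 0 < k ^ N.
  case: posnP kN => // ->; rewrite muln0 leqn0 muln_eq0 /= expn_eq0 //.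
(* Replacing [k.+2 ^ N] by 3/2 of [k ^ N] leaves a gain of 1/2 per index against a loss of 3 per
   query, hence the factor 6. *)
rewrite -(leq_pmul2r kN0); nia.
Qed.

End QueryLowerBound.

(** * The bits of a grid point *)

Section Lexicographic.
Variables (R : realType) (X : finType) (m k : nat) (c : nat -> X -> bool).
Local Notation node := (prefix_node X m c).
Local Notation code_fun := (code_fun R X m k c).

Lemma code_fun_eq w B x y :
  (forall j, j < m -> c j x = c j y) -> code_fun w B x = code_fun w B y.
Proof.
move=> cxy; congr (_%:R)%R; apply: eq_horner_digits => j jm; rewrite /digit cxy //.
suff -> : node j x = node j y by [].
by apply/eqP/prefix_node_eqP => [|i ij]; [exact: ltnW | exact/cxy/(ltn_trans ij)].
Qed.

(** Up to level [j] both points run through the same nodes, so the weights agree and the first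
    difference between the digits is that of the possibly flipped bits at [j]. *)
Lemma code_fun_lt w B x y j : j < m -> (forall i, i < j -> c i x = c i y) ->
  c j x (+) B (node j x) = false -> c j y (+) B (node j y) = true ->
  (code_fun w B x < code_fun w B y)%R.
Proof.
move=> jm cxy bx bY; rewrite ltr_nat.
have nodeE i : i <= j -> node i x = node i y.
  move=> ij; apply/eqP/prefix_node_eqP => [|i' i'i].
    exact: leq_trans ij (ltnW jm).
  exact/cxy/(leq_trans i'i).
apply: (@ltn_horner_digits _ _ _ _ j) => //.
- by move=> i im; exact: digit_lt.
- by move=> i ij; rewrite /digit cxy // nodeE // ltnW.
by rewrite /digit bx bY nodeE // addn0 addn1.
Qed.

End Lexicographic.

Lemma odd_expn2_div a k : a %/ 2 ^ k = 2 * (a %/ 2 ^ k.+1) + odd (a %/ 2 ^ k).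
Proof.
by rewrite expnSr divnMA divn2 mul2n addnC odd_double_half.
Qed.

Lemma eq_divn_bits l k a b : a < 2 ^ l.+1 -> b < 2 ^ l.+1 -> k <= l.+1 ->
  (forall k', k <= k' <= l -> odd (a %/ 2 ^ k') = odd (b %/ 2 ^ k')) ->
  a %/ 2 ^ k = b %/ 2 ^ k.
Proof.
move=> al bl; move: {2}(l.+1 - k) (erefl (l.+1 - k)) => r.
elim: r k => [|r IH] k kr kl ab.
  have -> : k = l.+1 by apply/eqP; rewrite eqn_leq kl -subn_eq0 kr.
  by rewrite !divn_small.
rewrite (odd_expn2_div a) (odd_expn2_div b) ab; last by lia.
rewrite (IH k.+1) //; try lia.
by move=> k' kk'; apply: ab; lia.
Qed.

Section Grid.
Variables (R : realType) (n d l k0 : nat).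
Hypothesis n_lt : n < 2 ^ l.+1.
Local Notation X := (hypergrid n d).
Implicit Types (x y z : X) (i : 'I_d).

Definition coord x (i : nat) : nat := oapp (fun o : 'I_d => x o : nat) 0 (insub i).

(** Each coordinate takes [l.+1] consecutive levels, from bit [l] down to bit 0; thus a node knows
    the earlier coordinates and the leading bits of the current one. *)
Definition grid_bit (j : nat) x : bool :=
  odd (coord x (j %/ l.+1) %/ 2 ^ (l - j %% l.+1)).

Definition level (i k : nat) : nat := i * l.+1 + (l - k).

Local Notation m := (d * l.+1).
Local Notation node := (prefix_node X m grid_bit).

Lemma level_div i k : level i k %/ l.+1 = i.
Proof. by rewrite /level divnMDl // divn_small ?addn0 // ltnS leq_subr. Qed.

Lemma level_mod i k : k <= l -> l - level i k %% l.+1 = k.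
Proof.
by move=> kl; rewrite /level modnMDl modn_small ?ltnS ?leq_subr // subKn.
Qed.

Lemma level_lt i k : level i k < m.
Proof. clear n_lt; have := ltn_ord i; rewrite /level; nia. Qed.

Lemma grid_bit_level i k x : k <= l -> grid_bit (level i k) x = odd (x i %/ 2 ^ k).
Proof. by move=> kl; rewrite /grid_bit level_div level_mod // /coord valK. Qed.

Lemma grid_bit_prefixP i k x y : k <= l ->
  (forall j, j < level i k -> grid_bit j x = grid_bit j y) <->
  (forall i' : 'I_d, i' < i -> x i' = y i') /\ x i %/ 2 ^ k.+1 = y i %/ 2 ^ k.+1.
Proof.
move=> kl; split=> [H|[H1 H2] j jl].
  have small (u : X) (o : 'I_d) : u o < 2 ^ l.+1 by exact: ltn_trans (ltn_ord _) n_lt.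
  split=> [i' ii'|].
    apply/val_inj; rewrite /= -[LHS]divn1 -[RHS]divn1 -(expn0 2).
    apply: (@eq_divn_bits l) => // k' k'l.
    rewrite -!grid_bit_level; try lia.
    by apply: H; rewrite /level; nia.
  apply: (@eq_divn_bits l) => // k' k'l; rewrite -!grid_bit_level; try lia.
  by apply: H; rewrite /level; lia.
have jE := divn_eq j l.+1; have jm : j %% l.+1 < l.+1 by rewrite ltn_mod.
have jd : j %/ l.+1 < d by have := ltn_ord i; move: jl; rewrite /level; nia.
have coordE (u : X) : coord u (j %/ l.+1) = u (Ordinal jd).
  by rewrite /coord -[j %/ l.+1]/(val (Ordinal jd)) valK.
rewrite /grid_bit !coordE.
have : j %/ l.+1 <= i by move: jl; rewrite /level; nia.
rewrite leq_eqVlt => /orP[/eqP ji|ji]; last by rewrite (H1 (Ordinal jd)).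
have -> : Ordinal jd = i by apply: val_inj.
have -> : l - j %% l.+1 = k.+1 + (l - j %% l.+1 - k.+1) by move: jl; rewrite /level; nia.
by rewrite expnD !divnMA H2.
Qed.

Lemma nodeP i k x y : k <= l -> node (level i k) x = node (level i k) y <->
  (forall i' : 'I_d, i' < i -> x i' = y i') /\ x i %/ 2 ^ k.+1 = y i %/ 2 ^ k.+1.
Proof.
move=> kl; rewrite -grid_bit_prefixP //.
have lm : level i k <= m by exact/ltnW/level_lt.
by split=> [/eqP/(prefix_node_eqP _ _ _ _ _ _ lm)|H] //; apply/eqP/prefix_node_eqP.
Qed.

(** The code is nondecreasing in every coordinate. If [x] and [y] differ only at [i], their first
    differing bit belongs to coordinate [i]; the higher bits agree, so [x i <= y i] forces this bit
    to be 0 in [x] and 1 in [y]. *)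
Lemma unate_code_fun w : unate (code_fun R X m k0 grid_bit w pred0).
Proof.
move=> i; right => x y off xy.
have [/forallP same|] := boolP [forall j : 'I_m, grid_bit j x == grid_bit j y].
  rewrite (@code_fun_eq _ _ _ _ _ _ _ x y) // => j jm.
  exact/eqP/(same (Ordinal jm)).
rewrite negb_forall => /existsP[[j0 j0m] /= ne0].
have ex : exists j, grid_bit j x != grid_bit j y by exists j0.
case: (ex_minnP ex) => j ne jmin.
have jm : j < m by exact: leq_ltn_trans (jmin _ ne0) j0m.
have before j' : j' < j -> grid_bit j' x = grid_bit j' y.
  by move=> j'j; apply/eqP; apply/negPn/negP => /jmin; rewrite leqNgt j'j.
have l0 : 0 < l.+1 by [].
have jd : j %/ l.+1 < d by rewrite ltn_divLR.
pose i' := Ordinal jd; pose k := l - j %% l.+1.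
have kl : k <= l by rewrite leq_subr.
have jE : j = level i' k.
  by rewrite /level subKn -?divn_eq // -ltnS ltn_mod.
have [ii'|nii'] := eqVneq i' i; last first.
  by move: ne; rewrite jE !grid_bit_level // off // eqxx.
rewrite jE in before ne; have [_] := (iffLR (grid_bit_prefixP i' k x y kl)) before.
move: ne; rewrite !grid_bit_level // ii' => ne e.
have := leq_div2r (2 ^ k) xy; rewrite (odd_expn2_div (x i)) (odd_expn2_div (y i)) e leq_add2l.
move=> le; apply/ltW/(code_fun_lt _ _ _ _ _ _ _ _ _ (level i' k)) => //.
- exact: level_lt.
- rewrite grid_bit_level // ii' addbF.
  by case: odd ne le => //; case: odd.
rewrite grid_bit_level // ii' addbF.
by case: odd ne le => //; case: odd.
Qed.

End Grid.

(** * Blocks *)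

Lemma leq_card_pred_ord (n C : nat) (S : pred 'I_n) (phi : nat -> nat) :
  (forall t, t < C -> exists2 o : 'I_n, o = phi t :> nat & S o) ->
  (forall t u, t < C -> u < C -> phi t = phi u -> t = u) ->
  C <= #|S|.
Proof.
move=> phiS phi_inj; case: C phiS phi_inj => // C phiS phi_inj.
have n0 : 0 < n by have [u _ _] := phiS 0 isT; exact: leq_ltn_trans (ltn_ord u).
have phin t : t < C.+1 -> phi t < n by move=> /phiS[u <- _].
pose h (t : 'I_C.+1) : 'I_n := Ordinal (phin t (ltn_ord t)).
have h_inj : injective h.
  by move=> t u [] /phi_inj tu; apply: val_inj; apply: tu.
rewrite -[C.+1]card_ord -(card_codom h_inj).
apply: subset_leq_card; apply/fintype.subsetP => v /codomP[t ->].
have [u uE Su] := phiS t (ltn_ord t).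
by rewrite -topredE /= (_ : h t = u) //; apply: val_inj; rewrite /= uE.
Qed.

(** * Counting in dyadic intervals, possibly truncated to the whole range *)

Section DyadicInterval.
Variables (n K b : nat).
Hypotheses (n_gt0 : 0 < n) (b_lt : b < maxn 1 (n %/ 2 ^ K)).

Lemma dyadic_interval_end : b * 2 ^ K + minn (2 ^ K) n <= n.
Proof.
have [b0|b0] := posnP b; first by rewrite b0 mul0n add0n geq_minr.
have : b.+1 * 2 ^ K <= n.
  by rewrite -leq_divRL ?expn_gt0 //; move: b_lt; lia.
rewrite mulSn; have := geq_minl (2 ^ K) n; lia.
Qed.

Lemma card_dyadic_interval :
  minn (2 ^ K) n <= #|[pred a : 'I_n | a %/ 2 ^ K == b]|.
Proof.
have e := dyadic_interval_end.
apply: (@leq_card_pred_ord _ _ _ (fun t => b * 2 ^ K + t)); last by move=> *; lia.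
move=> t tl; have bn : b * 2 ^ K + t < n by lia.
exists (Ordinal bn) => //; rewrite /= divnMDl ?expn_gt0 //.
by rewrite divn_small ?addn0 //; lia.
Qed.

(* The pairs [a, a + 2 ^ k] with bit [k] of [a] clear cover at least half of
   the interval: it either contains a full period, or is most of one. *)
Lemma card_dyadic_pairs k : 3 * 2 ^ k <= 2 * minn (2 ^ K) n ->
  minn (2 ^ K) n <= 4 * #|[pred a : 'I_n | [&& a %/ 2 ^ K == b,
                             ~~ odd (a %/ 2 ^ k) & a + 2 ^ k < n]]|.
Proof.
have e := dyadic_interval_end; set L := minn _ _ in e * => Lk.
have LK : L <= 2 ^ K by exact: geq_minl.
have M0 : 0 < 2 ^ k by rewrite expn_gt0.
have kK : k < K.
  rewrite ltnNge; apply/negP => Kk.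
  have := leq_pexp2l (isT : 0 < 2) Kk; lia.
pose M := 2 ^ k; pose a := L %/ (2 * M).
have aM : a * (2 * M) <= L by exact: leq_trunc_div.
have aM' : L < a.+1 * (2 * M) by rewrite ltn_ceil // muln_gt0.
(* Each of the [a] full periods of length [2 * M] contains [M] lower ends. Without a full period,
   the lower ends are the first [L - M] points, and [3 * M <= 2 * L] makes these at least a quarter
   of [L]. *)
pose C := if a == 0 then L - M else a * M.
apply: (@leq_trans (4 * C)); first by rewrite /C; case: eqP => a0; rewrite /M in aM aM' *; nia.
rewrite leq_mul2l /=.
have bound t : t < C -> 2 * M * (t %/ M) + t %% M + M < L.
  have tM : t %% M < M by rewrite ltn_mod.
  rewrite /C; case: eqP => a0 tC.
    have tM' : t < M by rewrite a0 in aM'; lia.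
    by rewrite divn_small // modn_small // muln0; lia.
  have : (t %/ M).+1 <= a by rewrite ltn_divLR.
  by move=> /(leq_mul (leqnn (2 * M))); lia.
apply: (@leq_card_pred_ord _ _ _ (fun t => b * 2 ^ K + (2 * M * (t %/ M) + t %% M))).
  move=> t /bound tb; have bn : b * 2 ^ K + (2 * M * (t %/ M) + t %% M) < n by lia.
  exists (Ordinal bn) => //=; apply/and3P; split; last by rewrite -/M; lia.
    by rewrite divnMDl ?expn_gt0 // divn_small ?addn0 //; lia.
  have -> : b * 2 ^ K = 2 * (b * 2 ^ (K - k.+1)) * M.
    have {1}-> : K = k.+1 + (K - k.+1) by lia.
    by rewrite expnD expnS -/M; lia.
  set B := b * _.
  have -> : 2 * B * M + (2 * M * (t %/ M) + t %% M) = 2 * (B + t %/ M) * M + t %% M by lia.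
  by rewrite divnMDl // (divn_small (ltn_pmod t M0)) addn0 oddM.
move=> t u tC uC /addnI e'.
have tM : t %% M < M by rewrite ltn_mod.
have uM : u %% M < M by rewrite ltn_mod.
have q : t %/ M = u %/ M.
  have tM2 : t %% M < 2 * M by rewrite (leq_trans tM) // leq_pmull.
  have uM2 : u %% M < 2 * M by rewrite (leq_trans uM) // leq_pmull.
  have := congr1 (fun v => v %/ (2 * M)) e'.
  rewrite /= ![2 * M * _]mulnC !divnMDl ?muln_gt0 //.
  by rewrite (divn_small tM2) (divn_small uM2) !addn0.
by rewrite (divn_eq t M) (divn_eq u M) q; move: e'; rewrite q => /addnI ->.
Qed.
End DyadicInterval.

(** The pairs [x], [t x] are pairwise disjoint, so one disagreement in each pair gives that many
    distinct points. *)
Lemma leq_card_matching (X : finType) (T : eqType) (f g : X -> T) (S : pred X) (t : X -> X) :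
  {in S &, injective t} -> (forall x, S x -> ~~ S (t x)) ->
  (forall x, S x -> f x != g x \/ f (t x) != g (t x)) ->
  #|S| <= #|[pred x | f x != g x]|.
Proof.
move=> t_inj St fg; pose phi x := if f x != g x then x else t x.
have phi_inj : {in S &, injective phi}.
  move=> x y Sx Sy; rewrite /phi; case: ifP => _; case: ifP => _ //.
  - by move=> xy; have := St _ Sy; rewrite -xy; rewrite -topredE /= in Sx; rewrite Sx.
  - by move=> xy; have := St _ Sx; rewrite xy; rewrite -topredE /= in Sy; rewrite Sy.
  - exact: t_inj.
rewrite -(card_in_image phi_inj); apply: subset_leq_card.
apply/fintype.subsetP => y /fintype.imageP[x Sx ->]; rewrite inE /phi.
by case: ifP => // fgx; case: (fg x Sx) => //; rewrite fgx.
Qed.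

(** * Blocks of the grid, their flipped nodes and their sizes *)

Section Blocks.
Variables (n d l K : nat) (s : 'I_d).
Hypothesis n_lt : n < 2 ^ l.+1.
Local Notation X := (hypergrid n d).
Local Notation m := (d * l.+1).
Local Notation bit := (grid_bit n d l).
Local Notation node := (prefix_node X m bit).
Implicit Types (x y z : X) (i : 'I_d).

(** A block fixes the coordinates before [s], confines coordinate [s] to a dyadic interval of length
    [2 ^ K], and leaves the later ones free. The grid point [z] encodes it, with the index of the
    interval at [s]. *)
Definition in_block z x : bool :=
  [forall i : 'I_d, (if i < s then x i == z i else true)
                  && ((i == s) ==> (x i %/ 2 ^ K == z i))].

Lemma in_blockP z x : reflect
  ((forall i : 'I_d, i < s -> x i = z i) /\ x s %/ 2 ^ K = z s) (in_block z x).
Proof.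
apply: (iffP forallP) => [H|[H1 H2] i].
  split=> [i is_|]; first by have /andP[] := H i; rewrite is_ => /eqP.
  by have /andP[_] := H s; rewrite eqxx /= => /eqP.
apply/andP; split; first by case: ifP => // /H1 ->.
by apply/implyP => /eqP ->; apply/eqP.
Qed.

(** Normal form of the codes: zeros after [s] make the code of a block unique, and the bound at [s]
    keeps the intervals inside the range, or allows the whole range when [2 ^ K] exceeds [n]. *)
Definition is_block z : bool :=
  [forall i : 'I_d, ((i == s) ==> (z i < maxn 1 (n %/ 2 ^ K)))
                  && ((s < i) ==> (z i == 0 :> nat))].

Definition flipped (i : 'I_d) (k : nat) z : pred (m.-bseq bool) :=
  [pred v | [exists x, (node (level l i k) x == v) && in_block z x]].

(** A node at such a level already fixes everything on which membership in a block depends, so a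
    block is a union of subtrees rooted at that level. *)
Lemma in_block_node i k z x y : k <= l -> s <= i -> (i == s -> k < K) ->
  node (level l i k) x = node (level l i k) y -> in_block z x = in_block z y.
Proof.
move=> kl si iK /(nodeP n d l n_lt _ _ _ _ kl)[H1 H2].
have same (j : 'I_d) : j < s -> x j = y j by move=> js; apply: H1; exact: leq_trans js si.
have same_s : x s %/ 2 ^ K = y s %/ 2 ^ K.
  have [si'|si'|si'] := ltngtP s i; first by rewrite H1.
    by move: si; rewrite leqNgt si'.
  have iE : i = s by apply: val_inj.
  have -> : K = k.+1 + (K - k.+1) by rewrite iE eqxx in iK; have := iK isT; lia.
  by rewrite expnD !divnMA -iE H2.
apply/in_blockP/in_blockP => -[E1 E2]; split=> [j js|].
- by rewrite -same // E1.
- by rewrite -same_s.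
- by rewrite same // E1.
- by rewrite same_s.
Qed.

Lemma flipped_node i k z j x : k <= l -> s <= i -> (i == s -> k < K) -> j < m ->
  flipped i k z (node j x) = (j == level l i k) && in_block z x.
Proof.
move=> kl si iK jm; apply/existsP/andP => [[y /andP[/eqP e zy]]|[/eqP -> zx]]; last first.
  by exists x; rewrite eqxx.
have lm := level_lt d l i k.
have le : level l i k = j by apply: prefix_node_level e; exact: ltnW.
split; first by rewrite le.
by rewrite -(in_block_node i k z y x) // e le.
Qed.

(** The length of [v] gives the coordinate and the bit, and any point below [v] gives the block. *)
Lemma flipped_disjoint i k z i' k' z' v :
  k <= l -> s <= i -> (i == s -> k < K) -> k' <= l -> s <= i' ->
  is_block z -> is_block z' ->
  flipped i k z v -> flipped i' k' z' v -> [/\ i = i', k = k' & z = z'].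
Proof.
move=> kl si iK kl' si' bz bz' /existsP[x /andP[/eqP xv zx]] /existsP[y /andP[/eqP yv zy]].
have le : level l i k = level l i' k'.
  by apply: (prefix_node_level X m bit _ _ x y); rewrite ?xv ?yv //; exact/ltnW/level_lt.
have ii' : i = i' by apply: val_inj; rewrite /= -(level_div d l i k) le level_div.
have kk' : k = k' by rewrite -(level_mod d l i k) // le level_mod.
split=> //; subst i' k'.
move: zx; rewrite (in_block_node i k z x y) ?xv ?yv // => /in_blockP[z1 z2].
have /in_blockP[z1' z2'] := zy.
apply/ffunP => j; apply: val_inj => /=.
have [js|sj|js] := ltngtP j s.
- by rewrite -z1 // -z1'.
- have /andP[_] := forallP bz j; have /andP[_] := forallP bz' j.
  by rewrite sj /= => /eqP -> /eqP ->.
have -> : j = s by apply: val_inj.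
by rewrite -z2 -z2'.
Qed.

Lemma card_ffun_family (F : 'I_d -> pred 'I_n) :
  #|[pred x : X | [forall i, F i (x i)]]| = \prod_(i < d) #|F i|.
Proof.
rewrite -[RHS](big_map (fun i => #|F i|) xpredT id) /index_enum -enumT.
have := card_family F; rewrite foldrE => <-; rewrite /X /hypergrid.
apply: eq_card => x; rewrite [LHS]inE.
by apply/forallP/familyP.
Qed.

Definition block_dim (i : nat) : nat :=
  if i < s then 1 else if i == s then minn (2 ^ K) n else n.

Lemma prod_block_dim : \prod_(i < d) block_dim i = minn (2 ^ K) n * n ^ (d - s.+1).
Proof.
pose F := block_dim; rewrite -(big_mkord xpredT F) (big_cat_nat (n := s)) //=; last exact: ltnW.
rewrite (big_cat_nat (m := s) (n := s.+1)) //= big_nat1.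
rewrite big1_seq ?mul1n; last first.
  by move=> i; rewrite mem_index_iota /F /block_dim => /andP[_ /= ->].
rewrite {1}/F /block_dim ltnn eqxx; congr (_ * _).
rewrite (eq_big_nat _ _ (F2 := fun=> n)); first by rewrite prod_nat_const_nat.
move=> i /andP[si _]; rewrite /F /block_dim ltnNge (ltnW si) /=.
by rewrite gtn_eqF.
Qed.

Hypothesis n_gt0 : 0 < n.

Lemma card_blocks : n ^ s * maxn 1 (n %/ 2 ^ K) <= #|[pred z | is_block z]|.
Proof.
pose G (i : 'I_d) : pred 'I_n := fun a => ((i == s) ==> (a < maxn 1 (n %/ 2 ^ K)))
                  && ((s < i) ==> (a == 0 :> nat)).
rewrite (_ : #|_| = \prod_(i < d) #|G i|); last exact: card_ffun_family.
pose F (i : nat) := if i < s then n else if i == s then maxn 1 (n %/ 2 ^ K) else 1.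
apply: (@leq_trans (\prod_(i < d) F i)).
  rewrite -(big_mkord xpredT F) (big_cat_nat (n := s)) //=; last exact: ltnW.
  rewrite (big_cat_nat (m := s) (n := s.+1)) //= big_nat1 mulnA.
  rewrite [X in _ <= _ * X]big1_seq ?muln1; last first.
    move=> i; rewrite mem_index_iota /F => /andP[_ /andP[si _]].
    by rewrite ltnNge (ltnW si) /= gtn_eqF.
  rewrite {2}/F ltnn eqxx (eq_big_nat _ _ (F2 := fun=> n)) ?prod_nat_const_nat ?subn0 //.
  by move=> i /andP[_ is_]; rewrite /F is_.
apply: leq_prod => i _; rewrite /F.
have [is_|si|/val_inj ->] := ltngtP i s.
- rewrite -[X in X <= _]card_ord; apply: subset_leq_card; apply/fintype.subsetP => a _.
  by rewrite /in_mem /= /G -val_eqE /= (ltn_eqF is_) [s < i]ltnNge (ltnW is_).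
- apply/card_gt0P; exists (Ordinal n_gt0).
  by rewrite /in_mem /= /G -val_eqE /= (gtn_eqF si) si.
apply: (@leq_card_pred_ord _ _ _ id) => // t tM.
have tn : t < n.
  by apply: (leq_trans tM); rewrite geq_max n_gt0 leq_div.
by exists (Ordinal tn) => //; rewrite /G /= eqxx ltnn tM.
Qed.

Definition block_pairs z i k : pred X :=
  [pred x | [&& in_block z x, ~~ odd (x i %/ 2 ^ k) & x i + 2 ^ k < n]].

(** The lower ends of the pairs form a product set, so the comparison with the block size reduces to
    coordinate [i]. *)
Lemma card_block_pairs q z i k : is_block z -> s <= i ->
  (if i == s then minn (2 ^ K) n <= q * #|[pred a : 'I_n | [&& a %/ 2 ^ K == z s,
                             ~~ odd (a %/ 2 ^ k) & a + 2 ^ k < n]]|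
   else n <= q * #|[pred a : 'I_n | ~~ odd (a %/ 2 ^ k) && (a + 2 ^ k < n)]|) ->
  minn (2 ^ K) n * n ^ (d - s.+1)
    <= q * #|block_pairs z i k|.
Proof.
move=> bz si good.
pose F (j : 'I_d) : pred 'I_n := fun a =>
  [&& (if j < s then a == z j else true), ((j == s) ==> (a %/ 2 ^ K == z j)) &
    (j == i) ==> ~~ odd (a %/ 2 ^ k) && (a + 2 ^ k < n)].
have -> : #|block_pairs z i k| = \prod_(j < d) #|F j|.
  rewrite -card_ffun_family; apply: eq_card => x; rewrite -[LHS]topredE [RHS]inE /=.
  apply/andP/forallP => [[/forallP zx xi] j|H].
    have /andP[z1 z2] := zx j; rewrite /F z1 z2 /=.
    by apply/implyP => /eqP ->.
  split; first by apply/forallP => j; have /and3P[-> ->] := H j.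
  by have /and3P[_ _] := H i; rewrite eqxx.
(* The factor [q] is spent on coordinate [i] alone, so that the two products can be compared factor
   by factor. *)
have qE : q = \prod_(j < d) (if j == i then q else 1).
  by rewrite -big_mkcond big_pred1_eq.
rewrite qE -big_split -prod_block_dim /=; apply: leq_prod => j _.
have bs : z s < maxn 1 (n %/ 2 ^ K).
  by have /andP[+ _] := forallP bz s; rewrite eqxx.
rewrite /block_dim; have [js|sj|/val_inj js] := ltngtP j s.
- have ji : (j == i) = false by apply/negbTE; rewrite -val_eqE /= ltn_eqF // (leq_trans js).
  rewrite ji mul1n; apply/card_gt0P; exists (z j).
  by rewrite /in_mem /= /F js eqxx ji -val_eqE /= (ltn_eqF js).
- have js' : (j == s) = false by rewrite -val_eqE /= gtn_eqF.
  case: eqP => [ji|/eqP/negbTE ji].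
    rewrite -ji js' in good; apply: (leq_trans good).
    apply: leq_mul => //; apply: subset_leq_card; apply/fintype.subsetP => a.
    by rewrite inE /in_mem /= /F [j < s]ltnNge (ltnW sj) js' ji eqxx.
  rewrite mul1n -[X in X <= _](card_ord n); apply: subset_leq_card; apply/fintype.subsetP => a _.
  by rewrite /in_mem /= /F [j < s]ltnNge (ltnW sj) js' ji.
rewrite js; case: eqP => [ji|/eqP/negbTE ji].
  rewrite -ji eqxx in good.
  apply: (leq_trans good).
  apply: leq_mul => //; apply: subset_leq_card; apply/fintype.subsetP => a.
  by rewrite inE /in_mem /= /F ltnn -ji eqxx.
rewrite mul1n; apply: (leq_trans (@card_dyadic_interval n K (z s) n_gt0 bs)).
apply: subset_leq_card; apply/fintype.subsetP => a.
by rewrite inE /in_mem /= /F ltnn ji eqxx /= => ->.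
Qed.

End Blocks.

(** * Distance to unateness *)

Section Shift.
Variables (n d : nat).
Local Notation X := (hypergrid n d).
Implicit Types (x y : X) (i : 'I_d).

(** Outside the range the default keeps the coordinate unchanged; all uses assume [x i + a < n]. *)
Definition shift i (a : nat) x : X :=
  [ffun j => if j == i then insubd (x i) (x i + a) else x j].

Lemma shift_same i a x : x i + a < n -> shift i a x i = x i + a :> nat.
Proof. by move=> xa; rewrite ffunE eqxx insubdK. Qed.

Lemma shift_other i a x j : j != i -> shift i a x j = x j.
Proof. by move=> /negbTE ji; rewrite ffunE ji. Qed.

Lemma shift_inj i a x y : x i + a < n -> y i + a < n ->
  shift i a x = shift i a y -> x = y.
Proof.
move=> xa ya e; apply/ffunP => j; have [->|ji] := eqVneq j i.
  apply: val_inj; apply/eqP; rewrite /= -(eqn_add2r a).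
  by rewrite -(shift_same _ _ _ xa) -(shift_same _ _ _ ya) e.
by rewrite -(shift_other i a x) // e shift_other.
Qed.

Lemma odd_div_shift i k x : ~~ odd (x i %/ 2 ^ k) -> x i + 2 ^ k < n ->
  odd (shift i (2 ^ k) x i %/ 2 ^ k)
  /\ shift i (2 ^ k) x i %/ 2 ^ k.+1 = x i %/ 2 ^ k.+1.
Proof.
move=> ev xn; rewrite shift_same // expnSr !divnMA.
rewrite divnDr // divnn expn_gt0 /= addn1 /= ev; split=> //.
by rewrite !divn2 -[_.+1./2]/(uphalf _) uphalf_half (negbTE ev).
Qed.

(** A unate [g] is monotone along [i] in one direction, so it disagrees with [f] on every pair of
    the opposite direction. Pairs of one family are disjoint, since bit [k] is clear at the lower
    end and set at the upper one. *)
Lemma far_from_unate_pairs (R : realType) (eps : R) (f : X -> R) i k1 k2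
    (S1 S2 : pred X) :
  (forall x, S1 x -> [/\ ~~ odd (x i %/ 2 ^ k1), x i + 2 ^ k1 < n &
                         (f (shift i (2 ^ k1) x) < f x)%R]) ->
  (forall x, S2 x -> [/\ ~~ odd (x i %/ 2 ^ k2), x i + 2 ^ k2 < n &
                         (f x < f (shift i (2 ^ k2) x))%R]) ->
  (eps * #|X|%:R <= #|S1|%:R)%R -> (eps * #|X|%:R <= #|S2|%:R)%R ->
  far_from_unate eps f.
Proof.
move=> S1P S2P c1 c2 g ug.
have le k x : x i + 2 ^ k < n ->
    agree_off i x (shift i (2 ^ k) x) /\ x i <= shift i (2 ^ k) x i.
  move=> xn; split; last by rewrite shift_same // leq_addr.
  by move=> j ji; rewrite shift_other.
have main (S : pred X) k : (eps * #|X|%:R <= #|S|%:R)%R ->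
    (forall x, S x -> [/\ ~~ odd (x i %/ 2 ^ k), x i + 2 ^ k < n &
       ~ (f x = g x /\ f (shift i (2 ^ k) x) = g (shift i (2 ^ k) x))]) ->
    (eps * #|X|%:R <= #|[pred x | f x != g x]|%:R)%R.
  move=> cS SP; apply: (le_trans cS); rewrite ler_nat.
  apply: (@leq_card_matching _ _ _ _ _ (shift i (2 ^ k))).
  - by move=> x y /SP[_ xn _] /SP[_ yn _]; apply: shift_inj.
  - move=> x /SP[ev xn _]; apply/negP => /SP[].
    by have [-> _] := odd_div_shift _ _ _ ev xn.
  - move=> x /SP[_ _ ne]; have [fx|] := eqVneq (f x) (g x); last by left.
    by right; apply/eqP => fy; apply: ne.
have [mono|mono] := ug i.
- apply: (main S2 k2) => // x /S2P[ev xn lt]; split=> // -[fx fy].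
  have [off le'] := le k2 x xn; have := mono _ _ off le'.
  by rewrite -fx -fy leNgt lt.
- apply: (main S1 k1) => // x /S1P[ev xn lt]; split=> // -[fx fy].
  have [off le'] := le k1 x xn; have := mono _ _ off le'.
  by rewrite -fx -fy leNgt lt.
Qed.
End Shift.

(** * Flipped codes are far from unate *)

Section Far.
Variables (R : realType) (n d l k0 K : nat) (s : 'I_d).
Hypotheses (n_gt0 : 0 < n) (n_lt : n < 2 ^ l.+1).
Local Notation X := (hypergrid n d).
Local Notation m := (d * l.+1).
Local Notation bit := (grid_bit n d l).
Local Notation node := (prefix_node X m bit).
Local Notation code_fun := (code_fun R X m k0 bit).
Local Notation in_block := (in_block n d K s).
Local Notation is_block := (is_block n d K s).
Local Notation flipped := (flipped n d l K s).
Implicit Types (x y z : X) (i : 'I_d).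

Lemma code_fun_shift w (B : pred (m.-bseq bool)) i k x : k <= l ->
  ~~ odd (x i %/ 2 ^ k) -> x i + 2 ^ k < n ->
  if B (node (level l i k) x)
  then (code_fun w B (shift n d i (2 ^ k) x) < code_fun w B x)%R
  else (code_fun w B x < code_fun w B (shift n d i (2 ^ k) x))%R.
Proof.
move=> kl ev xn; set y := shift _ _ _ _ _.
have [yo yd] : odd (y i %/ 2 ^ k) /\ y i %/ 2 ^ k.+1 = x i %/ 2 ^ k.+1.
  exact: odd_div_shift.
have pre : (forall i' : 'I_d, i' < i -> x i' = y i') /\ x i %/ 2 ^ k.+1 = y i %/ 2 ^ k.+1.
  by split=> // j ji; rewrite /y shift_other // -val_eqE /= ltn_eqF.
have nodeE : node (level l i k) x = node (level l i k) y by apply/nodeP.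
have bitE : forall j, j < level l i k -> bit j x = bit j y by apply/grid_bit_prefixP.
case: ifP => BE; apply: (code_fun_lt _ _ _ _ _ _ _ _ _ (level l i k)).
- exact: level_lt.
- by move=> j jl; rewrite bitE.
- by rewrite grid_bit_level // -nodeE BE yo.
- by rewrite grid_bit_level // BE (negbTE ev).
- exact: level_lt.
- exact: bitE.
- by rewrite grid_bit_level // BE (negbTE ev).
- by rewrite grid_bit_level // -nodeE BE yo.
Qed.

(** Inside the block, steps of [2 ^ k] along [i] become decreasing, while steps of [2 ^ k.+1]
    involve the next higher bit, whose level is not flipped, and stay increasing. Each family has at
    least a quarter as many pairs as the block has points. The factor 3 leaves room for the longer
    step. *)
Lemma far_flipped (eps : R) w i k z : is_block z -> s <= i ->
  3 * 2 ^ k <= (if i == s then minn (2 ^ K) n else n) ->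
  (4 * eps * #|X|%:R <= (minn (2 ^ K) n * n ^ (d - s.+1))%:R)%R ->
  far_from_unate eps (code_fun w (flipped i k z)).
Proof.
move=> bz si good big.
have kn : 3 * 2 ^ k <= n by move: good; case: ifP => _ //; rewrite leq_min => /andP[].
have kl : k < l.
  rewrite -(ltn_exp2l _ _ (isT : 1 < 2)).
  by move: n_lt kn; rewrite expnS; have := expn_gt0 2 k; lia.
have iK : i == s -> k < K.
  move=> is_; rewrite is_ leq_min in good; case/andP: good => good _.
  rewrite ltnNge; apply/negP => Kk; have := leq_pexp2l (isT : 0 < 2) Kk.
  by have := expn_gt0 2 k; lia.
have card_pairs k' : k' <= k.+1 ->
    (eps * #|X|%:R <= #|block_pairs n d K s z i k'|%:R)%R.
  move=> k'k; have k'k2 := leq_pexp2l (isT : 0 < 2) k'k; rewrite expnS in k'k2.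
  have : minn (2 ^ K) n * n ^ (d - s.+1) <= 4 * #|block_pairs n d K s z i k'|.
    apply: card_block_pairs => //; case: ifP good => _ good.
      apply: card_dyadic_pairs => //; last lia.
      by have /andP[+ _] := forallP bz s; rewrite eqxx.
    have nl : n <= 2 ^ l.+1 by exact: ltnW.
    (* A coordinate after [s] is unrestricted: its whole range is the single interval of index 0 at
       scale [l.+1]. *)
    have := @card_dyadic_pairs n l.+1 0 n_gt0 (leq_maxl 1 _) k'.
    rewrite (minn_idPr nl) => /(_ _)/leq_trans; apply; first lia.
    rewrite leq_mul2l /=; apply: subset_leq_card; apply/fintype.subsetP => a.
    by rewrite !inE => /and3P[_ -> ->].
  by rewrite -(ler_nat R) (natrM _ 4) => le; move: (le_trans big le); rewrite -mulrA ler_pM2l.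
apply: (@far_from_unate_pairs _ _ _ _ _ i k k.+1 _ _ _ _ (card_pairs k (leqnSn k))
   (card_pairs k.+1 (leqnn _))) => x /and3P[zx ev xn]; split=> //.
  have := code_fun_shift w (flipped i k z) i k x (ltnW kl) ev xn.
  by rewrite flipped_node ?eqxx ?zx //; [exact: ltnW | exact: level_lt].
have := code_fun_shift w (flipped i k z) i k.+1 x kl ev xn.
rewrite flipped_node //; [|exact: ltnW | exact: level_lt].
by rewrite (_ : _ == _ = false) //; apply/negbTE; rewrite /level; lia.
Qed.

End Far.

Lemma far_flipped2 (R : realType) (d l k0 : nat) (s : 'I_d) (eps : R) w
    (i : 'I_d) (z : hypergrid 2 d) : 0 < l ->
  is_block 2 d 0 s z -> s < i ->
  (2 * eps * #|hypergrid 2 d|%:R <= (2 ^ (d - s.+1))%:R)%R ->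
  far_from_unate eps (code_fun R (hypergrid 2 d) (d * l.+1) k0 (grid_bit 2 d l) w
                        (flipped 2 d l 0 s i 0 z)).
Proof.
move=> l0 bz si big.
have n_lt : 2 < 2 ^ l.+1 by rewrite -[X in X < _]expn1 ltn_exp2l.
have si' : s <= i := ltnW si.
have iK : i == s -> 0 < 0 by rewrite -val_eqE /= gtn_eqF.
have isE : (i == s) = false by rewrite -val_eqE /= gtn_eqF.
(* The block on the other side of coordinate [s] is not flipped and supplies the increasing
   pairs. *)
pose z' : hypergrid 2 d := [ffun j => if j == s then rev_ord (z s) else z j].
have bz' : is_block 2 d 0 s z'.
  apply/forallP => j; have /andP[_ z0] := forallP bz j.
  rewrite ffunE; have [->|js] := eqVneq j s; last exact: z0.
  by rewrite ltnn andbT; apply: (leq_trans (ltn_ord _)).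
have card_pairs z1 : is_block 2 d 0 s z1 ->
    (eps * #|hypergrid 2 d|%:R <= #|block_pairs 2 d 0 s z1 i 0|%:R)%R.
  move=> bz1.
  have le : minn (2 ^ 0) 2 * 2 ^ (d - s.+1) <= 2 * #|block_pairs 2 d 0 s z1 i 0|.
    apply: card_block_pairs => //; rewrite isE.
    have : 1 <= #|[pred a : 'I_2 | ~~ odd (a %/ 2 ^ 0) && (a + 2 ^ 0 < 2)]|.
      by apply/card_gt0P; exists ord0.
    lia.
  move: le; rewrite mul1n -(ler_nat R) (natrM _ 2) => le.
  by move: (le_trans big le); rewrite -mulrA ler_pM2l.
apply: (@far_from_unate_pairs _ _ _ _ _ i 0 0 _ _ _ _ (card_pairs z bz) (card_pairs z' bz'))
  => x /and3P[zx ev xn]; split=> //.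
  have := code_fun_shift R 2 d l k0 n_lt w (flipped 2 d l 0 s i 0 z) i 0 x (leq0n _) ev xn.
  by rewrite flipped_node ?eqxx ?zx //; exact: level_lt.
have := code_fun_shift R 2 d l k0 n_lt w (flipped 2 d l 0 s i 0 z) i 0 x (leq0n _) ev xn.
rewrite flipped_node //; last exact: level_lt.
rewrite eqxx (_ : in_block _ _ _ _ z x = false) //.
apply/negbTE/negP => /in_blockP[_]; have /in_blockP[_ ->] := zx.
rewrite ffunE eqxx /=; have := ltn_ord (z s); lia.
Qed.

(** * Choice of the parameters *)

(** Bernoulli's inequality: [(1 - 2 / (k + 2)) ^ N] is at least [1 - 2 * N / (k + 2)], which is at
    least 2/3 for [k = 6 * N]. *)
Lemma exists_alphabet_size N : exists k, 2 * k.+2 ^ N <= 3 * k ^ N.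
Proof.
have bern a : a.+2 ^ N * (a.+2 - 2 * N) <= a.+2 * a ^ N.
  elim: N => [|N IH]; first by rewrite !expn0 subn0 mul1n muln1.
  have [small|big] := leqP a.+2 (2 * N.+1).
    by rewrite (_ : a.+2 - 2 * N.+1 = 0) ?muln0 //; lia.
  have step : a.+2 * (a.+2 - 2 * N.+1) <= (a.+2 - 2 * N) * a by nia.
  rewrite !expnS -mulnA [a.+2 * (_ * _)]mulnCA.
  apply: (leq_trans (leq_mul (leqnn _) step)).
  by rewrite mulnA [a * _]mulnC mulnA leq_mul.
exists (6 * N).
have := bern (6 * N); rewrite (_ : (6 * N).+2 - 2 * N = 4 * N + 2); last by lia.
move=> H; rewrite -(leq_pmul2r (ltn0Sn (6 * N).+1)).
have := leq_mul (leqnn 3) H; set u := _ ^ N; set v := _ ^ N; nia.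
Qed.

Section TesterBound.
Variables (R : realType) (n d l K : nat) (s : 'I_d) (eps : R).
Hypotheses (n_gt0 : 0 < n) (n_lt : n < 2 ^ l.+1).
Variables (disp : measure_display) (Omega : measurableType disp).
Variables (P : probability Omega R) (A : Omega -> query_algo (hypergrid n d) R) (q : nat).

(** The flips are indexed by pairs of a level in [G] and a block. They are disjoint and yield far
    functions, so the query lower bound applies to their number. *)
Lemma levels_blocks_le (G : pred ('I_d * 'I_l.+1)) :
  (forall p, G p -> s <= p.1 /\ (p.1 == s -> p.2 < K)) ->
  (forall k w p z, G p -> is_block n d K s z ->
     far_from_unate eps (code_fun R (hypergrid n d) (d * l.+1) k (grid_bit n d l) w
                           (flipped n d l K s p.1 p.2 z))) ->
  unateness_tester eps P A -> makes_at_most A q ->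
  #|G| * (n ^ s * maxn 1 (n %/ 2 ^ K)) <= 6 * q.
Proof.
move=> Gs Gfar [mA yes no] Aq.
apply: (leq_trans (leq_mul (leqnn _) (card_blocks n d K s n_gt0))).
have [k kN] := exists_alphabet_size #|{: (d * l.+1).-bseq bool}|.
pose E (e : 'I_d * 'I_l.+1 * hypergrid n d) := G e.1 && is_block n d K s e.2.
rewrite (_ : #|G| * _ = #|E|); last first.
  by rewrite -cardX; apply: eq_card => -[p z]; rewrite !inE.
apply: (@query_lower_bound R _ (d * l.+1) k (grid_bit n d l) _ E
  (fun e => flipped n d l K s e.1.1 e.1.2 e.2) _ _ _ P A q) => //.
- move=> [[i k1] z] [[i' k1'] z'] v /andP[/= Gp bz] /andP[/= Gp' bz'] fv fv'.
  have [/= si iK] := Gs _ Gp; have [/= si' _] := Gs _ Gp'.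
  have kl : k1 <= l by rewrite -ltnS ltn_ord.
  have kl' : k1' <= l by rewrite -ltnS ltn_ord.
  have [-> kk' ->] := flipped_disjoint _ _ _ _ _ n_lt _ _ _ _ _ _ _ kl si iK kl' si' bz bz' fv fv'.
  by rewrite (val_inj kk').
- by move=> w; apply/yes/unate_code_fun.
- move=> [p z] w /andP[Gp bz] /=; set f := code_fun _ _ _ _ _ _ _.
  have := no f (Gfar _ _ _ _ Gp bz).
  rewrite (_ : [set t | ~~ accepts (A t) f] = ~` [set t | accepts (A t) f])%classic; last first.
    by apply/seteqP; split=> t /= /negP.
  rewrite probability_setC //.
  have /fineK <- : P [set t | accepts (A t) f]%classic \is a fin_num by exact: fin_num_measure.
  rewrite -EFinB !lee_fin; lra.
Qed.

End TesterBound.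

(** Here [N] is the size of the grid, [S] that of a block, [T] bounds the number of blocks from
    below and [G] is the number of levels. The constant is [288 = 3 * 16 * 6]: the logarithm is at
    most [3 * G], [T] is at least [1 / (16 * eps)], and [G * T] is at most [6 * q]. *)
Lemma ln_div_le (R : realType) (eps : R) (N T S G q : nat) :
  (0 < eps -> (0 < N)%N -> eps * N%:R <= (2 ^ (3 * G))%:R ->
   (N <= 2 * T * S)%N -> S%:R <= 8 * eps * N%:R -> (G * T <= 6 * q)%N ->
   1 / 288 * (ln (eps * N%:R) / eps) <= q%:R)%R.
Proof.
move=> e0 N0 NG NTS Se GT.
have NR : (0 < N%:R :> R)%R by rewrite ltr0n.
have lnG : (ln (eps * N%:R) <= 3 * G%:R)%R.
  apply: (@le_trans _ _ (ln ((2 ^ (3 * G))%:R : R))%R).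
    by rewrite ler_ln ?posrE ?mulr_gt0 // ltr0n expn_gt0.
  rewrite natrX lnXn ?ltr0n // -[X in (X <= _)%R]mulr_natr natrM.
  have ln2 : (ln 2 <= 1 :> R)%R.
    by have := @le_ln1Dx R 1; rewrite (_ : 1 + 1 = 2)%R //; apply; lra.
  have G0 : (0 <= G%:R :> R)%R by rewrite ler0n.
  nra.
have Te : (1 <= 16 * T%:R * eps)%R.
  have : (N%:R <= 2 * T%:R * S%:R :> R)%R by rewrite -!natrM ler_nat.
  have T0 : (0 <= T%:R :> R)%R by rewrite ler0n.
  move=> H; rewrite -(ler_pM2r NR) mul1r.
  apply: (le_trans H).
  apply: (le_trans (ler_wpM2l _ Se)); first by rewrite mulr_ge0.
  lra.
have GTR : (G%:R * T%:R <= 6 * q%:R :> R)%R by rewrite -!natrM ler_nat.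
rewrite mulrA ler_pdivrMr //.
have G0 : (0 <= G%:R :> R)%R by rewrite ler0n.
have : (G%:R * 1 <= G%:R * (16 * T%:R * eps))%R by rewrite ler_wpM2l.
have : (G%:R * T%:R * eps <= 6 * q%:R * eps)%R by rewrite ler_pM2r.
lra.
Qed.

(** * Counting the levels that can be flipped *)

Section GoodLevels.
Variables (n d l K : nat) (s : 'I_d).
Hypotheses (n_gt0 : 0 < n) (n_lt : n < 2 ^ l.+1).

Definition num_scales (L : nat) : nat := #|[pred k : 'I_l.+1 | 3 * 2 ^ k <= L]|.

(** The admissible exponents form an initial segment, so their number is itself the first exponent
    that fails. *)
Lemma num_scalesP L : L <= n -> L < 3 * 2 ^ num_scales L.
Proof.
move=> Ln; rewrite ltnNge; apply/negP => H.
suff : (num_scales L).+1 <= num_scales L by rewrite ltnn.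
apply: (@leq_card_pred_ord _ _ _ id) => // t; rewrite ltnS => tg.
have tL : 3 * 2 ^ t <= L.
  by apply: leq_trans H; rewrite leq_mul2l leq_pexp2l.
have tl : t < l.+1.
  rewrite -(ltn_exp2l _ _ (isT : 1 < 2)).
  by move: n_lt; lia.
by exists (Ordinal tl).
Qed.

Definition good_level : pred ('I_d * 'I_l.+1) :=
  fun p => (s <= p.1) && (3 * 2 ^ p.2 <= if p.1 == s then minn (2 ^ K) n else n).

Lemma card_good_level :
  #|good_level| = num_scales (minn (2 ^ K) n) + (d - s.+1) * num_scales n.
Proof.
pose F (i : nat) := if i < s then 0 else if i == s then num_scales (minn (2 ^ K) n)
                    else num_scales n.
have -> : #|good_level| = \sum_(i < d) F i.
  rewrite -sum1_card big_mkcond -(pair_bigA _ (fun i k => if (i, k) \in good_level then 1 else 0)) /=.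
  apply: eq_bigr => i _; rewrite /F /num_scales -big_mkcond sum1_card.
  have [is_|si|/val_inj ->] := ltngtP i s.
  - by apply/eqP/pred0P.
  - apply: eq_card => k; rewrite [RHS]inE -[LHS]topredE /= -val_eqE /=.
    by rewrite gtn_eqF.
  - by apply: eq_card => k; rewrite [RHS]inE -[LHS]topredE /= eqxx.
rewrite -(big_mkord xpredT F) (big_cat_nat (n := s)) //=; last exact: ltnW.
rewrite (big_cat_nat (m := s) (n := s.+1)) //= big_nat1.
rewrite big1_seq ?add0n; last first.
  by move=> i; rewrite mem_index_iota /F => /andP[_ /= ->].
rewrite {1}/F ltnn eqxx; congr (_ + _).
rewrite (eq_big_nat _ _ (F2 := fun=> num_scales n)); first by rewrite sum_nat_const_nat.
by move=> i /andP[si _]; rewrite /F ltnNge (ltnW si) /= gtn_eqF.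
Qed.

(** The logarithm of the block size is bounded by the number of good levels, coordinate by
    coordinate. The factor 4 pays for coordinate [s], which may have no good level at all. *)
Lemma block_size_le : 3 <= n ->
  minn (2 ^ K) n * n ^ (d - s.+1) <= 4 * 2 ^ (3 * #|good_level|).
Proof.
move=> n3; rewrite card_good_level; set L := minn _ _; set p := d - _.
have Ln : L <= n by exact: geq_minr.
have := num_scalesP _ Ln; have := num_scalesP _ (leqnn n).
set g := num_scales n; set g' := num_scales L => ng Lg.
(* As [3 <= n], exponent 0 is admissible and [g] is positive, which lets [3 * 2 ^ g] be absorbed
   into [8 ^ g]. *)
have ng8 : n <= 2 ^ (3 * g).
  have : 0 < g by case: posnP ng => // ->; lia.
  case: g ng => // g ng _.
  have : 2 ^ g <= 2 ^ (3 * g) by rewrite leq_pexp2l // leq_pmull.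
  by rewrite mulnS expnD; move: ng; rewrite expnS; lia.
have : n ^ p <= 2 ^ (3 * (p * g)).
  rewrite mulnCA mulnC expnM; case: (p) => [|p']; first by rewrite !expn0.
  by rewrite leq_exp2r.
rewrite mulnDr expnD [4 * _]mulnA => np; apply: leq_mul np.
have : 2 ^ g' <= 2 ^ (3 * g') by rewrite leq_pexp2l // leq_pmull.
lia.
Qed.

End GoodLevels.

(** First the least power of [n] reaching [y] is taken, then the least [K]. Raising [K] by one at
    most doubles the size, so the minimal choice overshoots [y] by at most a factor 2. *)
Lemma exists_block_size (R : realType) (n d : nat) (y : R) : (0 < n)%N ->
  (1 < y -> y <= (n ^ d)%:R -> exists p K : nat, [/\ (p < d)%N,
     y <= (minn (2 ^ K) n * n ^ p)%:R & (minn (2 ^ K) n * n ^ p)%:R <= 2 * y])%R.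
Proof.
move=> n0 y1 yd.
have ex1 : exists p, (y <= (n ^ p)%:R)%R by exists d.
case: (ex_minnP ex1) => -[|p] yp pmin; first by move: yp; rewrite expn0 leNgt y1.
have np : ((n ^ p)%:R < y)%R.
  by rewrite ltNge; apply/negP => /pmin; rewrite ltnn.
have ex2 : exists K, (y <= (minn (2 ^ K) n * n ^ p)%:R)%R.
  by exists n; rewrite (minn_idPr _) -?expnS // ltnW // ltn_expl.
case: (ex_minnP ex2) => -[|K] yK Kmin.
  by move: yK; rewrite expn0 (minn_idPl n0) mul1n leNgt np.
exists p, K.+1; split=> //; first exact: pmin.
have lt : ((minn (2 ^ K) n * n ^ p)%:R < y)%R.
  by rewrite ltNge; apply/negP => /Kmin; rewrite ltnn.
apply: (@le_trans _ _ (2 * (minn (2 ^ K) n * n ^ p))%:R%R).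
  by rewrite ler_nat mulnA leq_mul2r orbC expnS; apply/orP; left; lia.
by rewrite natrM ler_pM2l // ltW.
Qed.

(** The complete dyadic intervals cover at least half of the range, the remainder being shorter than
    one of them. *)
Lemma leq_half_blocks n K : 0 < n -> n <= 2 * maxn 1 (n %/ 2 ^ K) * minn (2 ^ K) n.
Proof.
move=> n0; have M0 : 0 < 2 ^ K by rewrite expn_gt0.
have [nK|nK] := leqP n (2 ^ K).
  by have := leq_maxl 1 (n %/ 2 ^ K); nia.
have : 0 < n %/ 2 ^ K by rewrite divn_gt0 // ltnW.
have := divn_eq n (2 ^ K); have := ltn_pmod n M0.
rewrite (maxn_idPr _) //; nia.
Qed.

Lemma card_hypergrid n d : #|hypergrid n d| = n ^ d.
Proof. by rewrite card_ffun !card_ord. Qed.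

Lemma lower_bound_ge3 (R : realType) (n d : nat) (eps : R) (disp : measure_display)
    (Omega : measurableType disp) (P : probability Omega R)
    (A : Omega -> query_algo (hypergrid n d) R) (q : nat) :
  3 <= n -> (0 < eps -> eps < 1 / 4 -> 1 < eps * (n ^ d)%:R ->
  unateness_tester eps P A -> makes_at_most A q ->
  1 / 288 * (ln (eps * (n ^ d)%:R) / eps) <= q%:R)%R.
Proof.
move=> n3 e0 e4 eN tester Aq; have n0 : 0 < n by exact: leq_trans n3.
have N0 : 0 < n ^ d by rewrite expn_gt0 n0.
have NR : (0 < (n ^ d)%:R :> R)%R by rewrite ltr0n.
(* The target [4 * eps * n ^ d] is what [far_flipped] requires; it exceeds 1 because [eps * n ^ d]
   does, and fits in the grid because [eps < 1 / 4]. *)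
have [||p [K [pd yS Sy]]] := @exists_block_size R n d (4 * eps * (n ^ d)%:R)%R n0.
- lra.
- nra.
have sd : d - p.+1 < d by lia.
pose s := Ordinal sd; have sp : d - s.+1 = p by rewrite /=; lia.
(* The binary length is taken generously as [n.+1]; the count of good levels depends on [n], not on
   this length. *)
have n_lt : n < 2 ^ n.+1 by rewrite (ltn_trans (ltn_expl n (isT : 1 < 2))) // ltn_exp2l.
have GS := block_size_le n d n K s n0 n_lt n3; rewrite sp in GS.
apply: (@ln_div_le R eps (n ^ d) (n ^ s * maxn 1 (n %/ 2 ^ K)) (minn (2 ^ K) n * n ^ p)
  #|good_level n d n K s| q) => //.
- have : ((minn (2 ^ K) n * n ^ p)%:R <= 4 * (2 ^ (3 * #|good_level n d n K s|))%:R :> R)%R.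
    by rewrite -natrM ler_nat.
  lra.
- have dE : d = s + (1 + p) by rewrite /=; lia.
  rewrite {1}dE !expnD expn1.
  have := leq_mul (leqnn (n ^ s * n ^ p)) (leq_half_blocks n K n0).
  lia.
- lra.
apply: (@levels_blocks_le R n d n K s eps n0 n_lt _ _ P A q) => //.
- move=> [i k] /andP[/= si good]; split=> // /= is_.
  move: good; rewrite is_ leq_min => /andP[good _].
  rewrite ltnNge; apply/negP => Kk; have := leq_pexp2l (isT : 0 < 2) Kk.
  by have := expn_gt0 2 k; lia.
move=> k w [i k'] z /andP[/= si good] bz.
by apply: far_flipped => //; rewrite card_hypergrid sp.
Qed.

Lemma lower_bound_2 (R : realType) (d : nat) (eps : R) (disp : measure_display)
    (Omega : measurableType disp) (P : probability Omega R)
    (A : Omega -> query_algo (hypergrid 2 d) R) (q : nat) :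
  0 < d -> (0 < eps -> eps < 1 / 4 -> 1 < eps * (2 ^ d)%:R ->
  unateness_tester eps P A -> makes_at_most A q ->
  1 / 288 * (ln (eps * (2 ^ d)%:R) / eps) <= q%:R)%R.
Proof.
case: d A => // d A _ e0 e4 eN tester Aq.
have N0 : 0 < 2 ^ d.+1 by rewrite expn_gt0.
have NE : ((2 ^ d.+1)%:R = 2 * (2 ^ d)%:R :> R)%R by rewrite expnS natrM.
have NR : (0 < (2 ^ d)%:R :> R)%R by rewrite ltr0n expn_gt0.
(* Half of the grid, of size [2 ^ d], must contain the block, since coordinate [s] has to separate
   it from its sibling; [eps < 1 / 4] ensures this. *)
have [||p [K [pd yS Sy]]] := @exists_block_size R 2 d (2 * eps * (2 ^ d.+1)%:R)%R isT.
- lra.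
- rewrite NE; nra.
have [p' [pd' yS' Sy']] : exists p', [/\ p' <= d,
    (2 * eps * (2 ^ d.+1)%:R <= (2 ^ p')%:R)%R &
    ((2 ^ p')%:R <= 2 * (2 * eps * (2 ^ d.+1)%:R))%R].
  case: K yS Sy => [|K]; first by rewrite mul1n => *; exists p; split=> //; exact: ltnW.
  rewrite (minn_idPr _) ?expnS ?leq_pmulr ?expn_gt0 // => *.
  by exists p.+1; rewrite expnS.
have sd : d - p' < d.+1 by lia.
pose s := Ordinal sd; have sp : d.+1 - s.+1 = p' by rewrite /=; lia.
(* Only bit 0 of the free coordinates after [s] is flipped, one level for each of the [p']
   dimensions of the block. *)
pose G : pred ('I_d.+1 * 'I_3) := fun e => (s < e.1) && (e.2 == ord0).
have cardG : p' <= #|G|.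
  pose h (t : 'I_p') : 'I_d.+1 * 'I_3 := (inord (s.+1 + t), ord0).
  have hE (t : 'I_p') : @inord d (s.+1 + t) = s.+1 + t :> nat.
    have sE : s = d - p' :> nat by [].
    by rewrite inordK // sE; have := ltn_ord t; lia.
  have h_inj : injective h.
    by move=> t u [] /(congr1 val) /=; rewrite !hE => /addnI /val_inj.
  rewrite -[X in X <= _]card_ord -(card_codom h_inj).
  apply: subset_leq_card; apply/fintype.subsetP => v /codomP[t ->].
  by rewrite -topredE /= /G /= hE eqxx andbT leq_addr.
apply: (@ln_div_le R eps (2 ^ d.+1) (2 ^ s * maxn 1 (2 %/ 2 ^ 0)) (2 ^ p') #|G| q) => //.
- have : (2 ^ p' <= 2 ^ (3 * #|G|))%N by rewrite leq_pexp2l //; lia.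
  rewrite -(ler_nat R); lra.
- have dE : d.+1 = s.+1 + p' by rewrite /=; lia.
  rewrite {1}dE.
  rewrite expnD expnS (_ : maxn 1 (2 %/ 2 ^ 0) = 2) //; nia.
- have : (0 < eps * (2 ^ d.+1)%:R)%R by rewrite mulr_gt0 // ltr0n.
  lra.
apply: (@levels_blocks_le R 2 d.+1 2 0 s eps isT isT _ _ P A q) => //.
- move=> [i k] /andP[/= si /eqP ->]; split; first exact: ltnW.
  by move=> /eqP is_; move: si; rewrite is_ ltnn.
move=> k w [i k'] z /andP[/= si /eqP ->] bz.
by apply: far_flipped2 => //; rewrite card_hypergrid sp.
Qed.

Local Open Scope classical_set_scope.
Local Open Scope ring_scope.

Theorem theorem1p3 (R : realType) :
  exists2 c : R, 0 < c &
    forall (n d : nat) (eps : R),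
      (0 < n)%N -> (0 < d)%N -> 0 < eps -> eps < 1 / 4 ->
    forall (disp : measure_display) (Omega : measurableType disp)
      (P : probability Omega R) (A : Omega -> query_algo (hypergrid n d) R)
      (q : nat),
      unateness_tester eps P A -> makes_at_most A q ->
      c * (d%:R * ln (n%:R) / eps - ln (1 / eps) / eps) <= q%:R.
Proof.
exists (1 / 288) => [|n d eps n0 d0 e0 e4 disp Omega P A q tester Aq]; first by lra.
have N0 : 0 < (n ^ d)%:R :> R by rewrite ltr0n expn_gt0 n0.
(* The claimed bound is the logarithm of [eps * n ^ d], the allowed number of changed values,
   divided by [eps]. *)
have -> : d%:R * ln n%:R / eps - ln (1 / eps) / eps = ln (eps * (n ^ d)%:R) / eps.
  rewrite -mulrBl; congr (_ / _).
  rewrite lnM ?posrE // natrX lnXn ?ltr0n // mulr_natl div1r lnV ?posrE //.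
  by rewrite opprK addrC.
(* For [eps * n ^ d <= 1] the logarithm is at most 0 and the bound is trivial. Otherwise [n = 1] is
   excluded by [eps < 1 / 4]. *)
have [small|big] := leP (eps * (n ^ d)%:R) 1.
  apply: (@le_trans _ _ 0); last exact: ler0n.
  rewrite pmulr_rle0 //.
  by rewrite pmulr_lle0 ?invr_gt0 // ln_le0.
case: n n0 A N0 big tester Aq => [|[|[|n]]] // _ A N0 big tester Aq.
- have : 1 < eps by move: big; rewrite exp1n mulr1.
  lra.
- exact: lower_bound_2 tester Aq.
- exact: lower_bound_ge3 tester Aq.
Qed.
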